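(* Let $T$ be a continuous t-norm, $A=[a_{ij}]\in[0,1]^{n\times m}$ and $b=[b_i]\in[0,1]^{n\times 1}$. Let $\Delta=\inf_{c\in\mathcal C}\Vert b-c\Vert$ be the Chebyshev distance associated to the second member $b$ of the system $A\,\Box_T^{\max}\,x=b$. Then $$\Delta=\min\{\delta\in[0,1]\mid \underline b(\delta)\le F(\overline b(\delta))\}$$ (in particular this minimum is attained).
   Context: A t-norm is a map $T:[0,1]\times[0,1]\to[0,1]$ that is commutative, associative, increasing (in the wide sense) in the second variable and satisfies $T(x,1)=x$. Its residual implicator is $\mathcal I_T(x,y)=\sup\{z\in[0,1]\mid T(x,z)\le y\}$ for $x,y\in[0,1]$. $n,m\ge1$ are integers. For $c=[c_i]\in[0,1]^{n\times1}$, the system $A\,\Box_T^{\max}\,x=c$ is: find $x=[x_j]\in[0,1]^{m\times1}$ with $\max_{1\le j\le m}T(a_{ij},x_j)=c_i$ for all $i\in\{1,\dots,n\}$; it is consistent if such an $x$ exists. $\mathcal C=\{c\in[0,1]^{n\times1}\mid A\,\Box_T^{\max}\,x=c\text{ is consistent}\}$. $\Vert b-c\Vert=\max_{1\le i\le n}|b_i-c_i|$. The map $F:[0,1]^{n\times1}\to[0,1]^{n\times1}$ (depending on $A$ and $T$) is defined by $$F(c)_i=\max_{1\le j\le m}T\big(a_{ij},\min_{1\le k\le n}\mathcal I_T(a_{kj},c_k)\big),\qquad 1\le i\le n.$$ For $\delta\in[0,1]$, $\underline b(\delta)=[\max(b_i-\delta,0)]_{1\le i\le n}$ and $\overline b(\delta)=[\min(b_i+\delta,1)]_{1\le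 i\le n}$. The order $\le$ on $[0,1]^{n\times1}$ is componentwise. *)

(* Defs.v *)
From mathcomp Require Import all_boot all_order all_algebra.
From mathcomp Require Import all_classical all_reals all_analysis.
Import Order.TTheory GRing.Theory Num.Theory numFieldNormedType.Exports.

Set Implicit Arguments.
Unset Strict Implicit.
Unset Printing Implicit Defensive.

Local Open Scope classical_set_scope.
Local Open Scope ring_scope.

(* A map [0,1] x [0,1] -> [0,1] is represented by a total T : R -> R -> R of
   which only the values on the unit square are constrained. *)
Record tnorm (R : realType) (T : R -> R -> R) : Prop := Tnorm {
  tnorm_itv : forall x y, x \in `[0, 1] -> y \in `[0, 1] -> T x y \in `[0, 1];
  tnormC : {in `[0, 1] &, commutative T};
  tnormA : {in `[0, 1] & &, associative T};
  tnorm_homo : forall x, x \in `[0, 1] ->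
    {in `[0, 1] &, {homo T x : y z / y <= z}};
  tnormr1 : {in `[0, 1], right_id 1 T} }.

Definition tnorm_continuous (R : realType) (T : R -> R -> R) : Prop :=
  {within (`[0, 1] `*` `[0, 1] : set (R * R)),
    continuous (fun p : R * R => T p.1 p.2)}.

Definition residual (R : realType) (T : R -> R -> R) (x y : R) : R :=
  sup [set z : R | z \in `[0, 1] /\ T x z <= y].

Definition mx01 (R : realType) (p q : nat) (M : 'M[R]_(p, q)) : Prop :=
  forall i j, M i j \in `[0, 1].

(* On families in [0,1], the units 0 of max and 1 of min do not affect the
   result, so for non-empty index sets these are the plain max and min. *)
Definition max_comp (R : realType) (T : R -> R -> R) (n m : nat)
    (A : 'M[R]_(n, m)) (x : 'cV[R]_m) : 'cV[R]_n :=
  \col_i \big[Num.max/0]_(j < m) T (A i j) (x j 0).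

Definition min_res_comp (R : realType) (T : R -> R -> R) (n m : nat)
    (A : 'M[R]_(n, m)) (c : 'cV[R]_m) : 'cV[R]_n :=
  \col_i \big[Num.min/1]_(j < m) residual T (A i j) (c j 0).

Definition consistent (R : realType) (T : R -> R -> R) (n m : nat)
    (A : 'M[R]_(n, m)) (c : 'cV[R]_n) : Prop :=
  exists2 x : 'cV[R]_m, mx01 x & max_comp T A x = c.

Definition consistent_set (R : realType) (T : R -> R -> R) (n m : nat)
    (A : 'M[R]_(n, m)) : set 'cV[R]_n :=
  [set c | mx01 c /\ consistent T A c].

(* The norm on matrices is the maximum of the absolute values of the entries. *)
Definition chebyshev_dist (R : realType) (T : R -> R -> R) (n m : nat)
    (A : 'M[R]_(n, m)) (b : 'cV[R]_n) : R :=
  inf [set `|b - c| | c in consistent_set T A].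

Definition Fmap (R : realType) (T : R -> R -> R) (n m : nat)
    (A : 'M[R]_(n, m)) (c : 'cV[R]_n) : 'cV[R]_n :=
  max_comp T A (min_res_comp T A^T c).

Definition lower (R : realType) (n : nat) (b : 'cV[R]_n) (d : R) : 'cV[R]_n :=
  \col_i Num.max (b i 0 - d) 0.

Definition upper (R : realType) (n : nat) (b : 'cV[R]_n) (d : R) : 'cV[R]_n :=
  \col_i Num.min (b i 0 + d) 1.

Definition cV_le (R : realType) (n : nat) (u v : 'cV[R]_n) : Prop :=
  forall i, u i 0 <= v i 0.

Definition is_min (R : realType) (S : set R) (x : R) : Prop :=
  S x /\ lbound S x.

(* Main.v *)
(** Residuation makes [min_res_comp T A^T c] the greatest [x] in the unit cube
    with [max_comp T A x <= c], so [d] satisfies the inequality exactly when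
    [Fmap T A (upper b d)], which is always a consistent second member, lies
    within distance [d] of [b], and exactly when some consistent second member
    does.  Every such [d] therefore bounds the Chebyshev distance from above,
    and it remains to see that the distance D is attained: along d_N = D + 1/(N+1)
    the greatest solutions decrease to a limit [x], and continuity of T shows that
    [max_comp T A x] is at distance at most D from [b]. *)
Require Import Defs.
From mathcomp Require Import all_boot all_order all_algebra.
From mathcomp Require Import all_classical all_reals all_analysis.
From mathcomp Require Import lra.
Import Order.TTheory GRing.Theory Num.Theory numFieldNormedType.Exports.
Local Open Scope classical_set_scope.
Local Open Scope ring_scope.

(** * Limits of finite maxima, and the entrywise form of the norm *)

Lemma cvg_bigmax (R : realType) (I : Type) (r : seq I) (U : Type)
    (F : set_system U) {FF : Filter F} (x0 : R) (f : I -> U -> R) (l : I -> R) :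
    (forall i, f i u @[u --> F] --> l i) ->
  \big[Num.max/x0]_(i <- r) f i u @[u --> F] --> \big[Num.max/x0]_(i <- r) l i.
Proof.
move=> fl; elim: r => [|i r IH].
  by rewrite big_nil; under eq_fun do rewrite big_nil; exact: cvg_cst.
rewrite big_cons; under eq_fun do rewrite big_cons.
by apply: (continuous2_cvg FF _ (fl i) IH); exact: (@max_continuous _ R (_, _)).
Qed.

Lemma mx_norm_leP (R : realType) (n m : nat) (M : 'M[R]_(n, m)) (d : R) :
  0 <= d -> `|M| <= d <-> forall i j, `|M i j| <= d.
Proof.
move=> d0; rewrite -[`|M|]/(mx_norm M) mx_normrE; split.
  by move=> /bigmax_leP[_ Md] i j; exact: (Md (i, j)).
by move=> Md; apply/bigmax_leP; split=> // -[i j] _; exact: Md.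
Qed.

(** * The t-norm and its residual *)

Section solutions.
Variables (R : realType) (T : R -> R -> R).
Hypotheses (T_tnorm : tnorm T) (T_cont : tnorm_continuous T).

Let in0 : (0 : R) \in `[0, 1]. Proof. by rewrite in_itv /= lexx ler01. Qed.
Let in1 : (1 : R) \in `[0, 1]. Proof. by rewrite in_itv /= lexx ler01. Qed.

(** Commutativity gives [T x 0 = T 0 x], and monotonicity bounds this by [T 0 1 = 0]. *)
Lemma tnormr0 (x : R) : x \in `[0, 1] -> T x 0 = 0.
Proof.
move=> x01; apply/le_anti/andP; split; last first.
  by have := tnorm_itv T_tnorm x01 in0; rewrite in_itv /= => /andP[].
rewrite (tnormC T_tnorm) // -[leRHS](tnormr1 T_tnorm) //.
apply: (tnorm_homo T_tnorm) => //.
by move: x01; rewrite in_itv /= => /andP[].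
Qed.

Lemma tnorm_cvg (U : Type) (F : set_system U) {FF : Filter F} (x : R) (u : U -> R) (l : R) :
    x \in `[0, 1] -> (forall k, u k \in `[0, 1]) -> l \in `[0, 1] ->
  u k @[k --> F] --> l -> T x (u k) @[k --> F] --> T x l.
Proof.
move=> x01 u01 l01 ul.
have /subspace_continuousP/(_ (x, l)) := T_cont.
move=> /(_ (conj x01 l01)) Tl.
have xul : (x, u k) @[k --> F] --> (x, l).
  exact: (cvg_pair (cvg_cst x) ul).
(* [Tl] speaks only of points of the unit square; [x01] and [u01] place every [(x, u k)] there. *)
move=> W /Tl /xul FW; apply: (@filterS _ F FF _ _ _ FW) => k; apply.
by split; [exact: x01|exact: u01].
Qed.

Lemma residual_itv (x y : R) :
  x \in `[0, 1] -> y \in `[0, 1] -> residual T x y \in `[0, 1].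
Proof.
move=> x01 y01; have y0 : 0 <= y by move: y01; rewrite in_itv /= => /andP[].
rewrite in_itv /=; apply/andP; split.
  apply: ub_le_sup; first by exists 1 => z [+ _]; rewrite in_itv /= => /andP[].
  by split; rewrite ?tnormr0.
apply: ge_sup; first by exists 0; split; rewrite ?tnormr0.
by move=> z [+ _]; rewrite in_itv /= => /andP[].
Qed.

(** The supremum defining the residual belongs to its set: members within [harmonic N] of it
    converge to it, and continuity of [T] carries the bound [y] to the limit. *)
Lemma tnorm_residual_le (x y : R) :
  x \in `[0, 1] -> y \in `[0, 1] -> T x (residual T x y) <= y.
Proof.
move=> x01 y01; have y0 : 0 <= y by move: y01; rewrite in_itv /= => /andP[].
set S := [set z : R | z \in `[0, 1] /\ T x z <= y].
have S0 : S 0 by split; rewrite ?tnormr0.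
have supS : has_sup S.
  by split; [exists 0|exists 1 => z [+ _]; rewrite in_itv /= => /andP[]].
have /choice[u uP] : forall N, exists z, S z /\ sup S - harmonic N < z.
  move=> N; have [z Sz ltz] := sup_adherent (harmonic_gt0 N) supS.
  by exists z.
have usup : u N @[N --> \oo] --> sup S.
  apply: (@squeeze_cvgr _ _ _ _ (fun N => sup S - harmonic N) (fun=> sup S)).
  - apply: nearW => N; have [uS ltu] := uP N; rewrite ltW //=.
    by apply: ub_le_sup => //; exact: supS.2.
  - by rewrite -[X in _ --> X]subr0; apply: cvgB; [exact: cvg_cst|exact: cvg_harmonic].
  - exact: cvg_cst.
apply: (@ler_cvg_to _ \oo _ _ (fun N => T x (u N)) (fun=> y)).
- apply: tnorm_cvg => //; first by move=> N; case: (uP N) => -[].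
  exact: residual_itv.
- exact: cvg_cst.
- by apply: nearW => N; case: (uP N) => -[].
Qed.

Lemma tnorm_residualP (x y z : R) : x \in `[0, 1] -> y \in `[0, 1] -> z \in `[0, 1] ->
  T x z <= y <-> z <= residual T x y.
Proof.
move=> x01 y01 z01; split=> [Txz|zr].
  apply: ub_le_sup; last by [].
  by exists 1 => t [+ _]; rewrite in_itv /= => /andP[].
apply: le_trans (tnorm_residual_le _ _ x01 y01).
by apply: (tnorm_homo T_tnorm) => //; exact: residual_itv.
Qed.

(** * Residuation for systems *)

Variables (n m : nat) (A : 'M[R]_(n, m)).
Hypothesis A01 : mx01 A.
Implicit Types (b c : 'cV[R]_n) (x : 'cV[R]_m) (d : R).

Lemma cV_le_trans p (u v w : 'cV[R]_p) : cV_le u v -> cV_le v w -> cV_le u w.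
Proof. by move=> uv vw i; exact: le_trans (uv i) (vw i). Qed.

Lemma mx01_max_comp x : mx01 x -> mx01 (max_comp T A x).
Proof.
move=> x01 i j; rewrite mxE in_itv /=; apply/andP; split.
  exact: bigmax_ge_id.
apply: bigmax_le => // k _.
by have := tnorm_itv T_tnorm (A01 i k) (x01 k 0); rewrite in_itv /= => /andP[].
Qed.

Lemma le_max_comp x y : mx01 x -> mx01 y -> cV_le x y ->
  cV_le (max_comp T A x) (max_comp T A y).
Proof.
move=> x01 y01 xy i; rewrite !mxE; apply: le_bigmax2 => j _.
exact: (tnorm_homo T_tnorm).
Qed.

Lemma mx01_min_res_comp c : mx01 c -> mx01 (min_res_comp T A^T c).
Proof.
move=> c01 j k; rewrite mxE in_itv /=; apply/andP; split; last first.
  exact: bigmin_le_id.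
apply: le_bigmin => // i _; rewrite mxE.
by have := residual_itv _ _ (A01 i j) (c01 i 0); rewrite in_itv /= => /andP[].
Qed.

(** By the scalar adjunction both sides mean [T (A i j) (x j 0) <= c i 0] for all [i] and [j]; the
    default values 0 and 1 of the big operators are harmless inside the unit cube. *)
Lemma max_comp_leP x c : mx01 x -> mx01 c ->
  cV_le (max_comp T A x) c <-> cV_le x (min_res_comp T A^T c).
Proof.
move=> x01 c01; split=> [le_c j|le_r i]; rewrite mxE.
  apply: le_bigmin; first by have := x01 j 0; rewrite in_itv /= => /andP[].
  move=> i _; rewrite mxE; apply/tnorm_residualP => //.
  by apply: le_trans (le_c i); rewrite mxE; exact: (le_bigmax _ (fun j => _)).
apply: bigmax_le; first by have := c01 i 0; rewrite in_itv /= => /andP[].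
move=> j _; apply/tnorm_residualP => //.
apply: (le_trans (le_r j)); rewrite mxE.
by apply: (le_trans (bigmin_le _ i _)); rewrite mxE.
Qed.

(** An upper adjoint is monotone: a subsolution for [c] is also one for [c']. *)
Lemma le_min_res_comp c c' : mx01 c -> mx01 c' -> cV_le c c' ->
  cV_le (min_res_comp T A^T c) (min_res_comp T A^T c').
Proof.
move=> c01 c'01 cc'; have x01 := mx01_min_res_comp _ c01.
apply/max_comp_leP => //; apply: cV_le_trans cc'.
by apply/max_comp_leP => // j.
Qed.

Lemma Fmap_le c : mx01 c -> cV_le (Fmap T A c) c.
Proof. by move=> c01; apply/max_comp_leP => //; exact: mx01_min_res_comp. Qed.

Lemma mx01_upper b d : mx01 b -> 0 <= d -> mx01 (upper b d).
Proof.
move=> b01 d0 i j; rewrite mxE in_itv /= le_min ge_min ler01 lexx orbT !andbT.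
by have := b01 i 0; rewrite in_itv /= => /andP[? _]; exact: addr_ge0.
Qed.

(** Truncating the bounds at 0 and 1 loses nothing, since the entries of [c] lie in [0,1]. *)
Lemma mx01_dist_leP b c d : mx01 c -> 0 <= d ->
  `|b - c| <= d <-> cV_le (lower b d) c /\ cV_le c (upper b d).
Proof.
move=> c01 d0.
have eqv i : (`|(b - c) i 0| <= d) =
    (lower b d i 0 <= c i 0) && (c i 0 <= upper b d i 0).
  have := c01 i 0; rewrite in_itv /= => /andP[c0 c1].
  rewrite !mxE ge_max le_min c0 c1 !andbT ler_distlC andbC.
  by apply/idP/idP => /andP[? ?]; apply/andP; split; lra.
rewrite mx_norm_leP //; split=> [bcd|[lo up] i j].
  by split=> i; have := bcd i 0; rewrite eqv => /andP[].
by rewrite ord1 eqv lo up.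
Qed.

Section feasible.
Variables (b : 'cV[R]_n) (d : R).
Hypotheses (b01 : mx01 b) (d_ge0 : 0 <= d).

(** The other half of the distance bound, [Fmap T A (upper b d)] below [upper b d], always holds by
    [Fmap_le]. *)
Lemma lower_le_FmapP : cV_le (lower b d) (Fmap T A (upper b d)) <->
  `|b - Fmap T A (upper b d)| <= d.
Proof.
have up01 := mx01_upper _ _ b01 d_ge0.
rewrite mx01_dist_leP //; last by apply: mx01_max_comp; exact: mx01_min_res_comp.
by split=> [|[]//]; split=> //; exact: Fmap_le.
Qed.

(** Such an [x] lies below the greatest subsolution for [upper b d], and composition with [A] is
    monotone. *)
Lemma lower_le_Fmap x : mx01 x -> `|b - max_comp T A x| <= d ->
  cV_le (lower b d) (Fmap T A (upper b d)).
Proof.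
move=> x01 /mx01_dist_leP[] //; first exact: mx01_max_comp.
have up01 := mx01_upper _ _ b01 d_ge0.
move=> lo /(max_comp_leP _ _ x01 up01) le_x; apply: (cV_le_trans _ _ _ _ lo).
by apply: le_max_comp => //; exact: mx01_min_res_comp.
Qed.

End feasible.

Lemma max_comp_consistent x : mx01 x -> consistent_set T A (max_comp T A x).
Proof. by move=> x01; split; [exact: mx01_max_comp|exists x]. Qed.

(** * The Chebyshev distance and its attainment *)

Variable b : 'cV[R]_n.
Hypothesis b01 : mx01 b.

Lemma chebyshev_dist_ge0 : 0 <= chebyshev_dist T A b.
Proof.
apply: lb_le_inf; last by move=> _ [c _ <-].
(* A lower bound passes to the infimum only for a nonempty set; the zero vector supplies a
   member. *)
exists `|b - max_comp T A 0|; exists (max_comp T A 0) => //.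
by apply: max_comp_consistent => i j; rewrite mxE.
Qed.

Lemma chebyshev_dist_le x : mx01 x -> chebyshev_dist T A b <= `|b - max_comp T A x|.
Proof.
move=> x01; apply: ge_inf; first by exists 0 => _ [c _ <-].
by exists (max_comp T A x) => //; exact: max_comp_consistent.
Qed.

Lemma chebyshev_dist_le1 : chebyshev_dist T A b <= 1.
Proof.
have x01 : mx01 (0 : 'cV[R]_m) by move=> i j; rewrite mxE.
apply: (le_trans (chebyshev_dist_le _ x01)); apply/mx_norm_leP => // i j.
move: (max_comp T A 0) (mx01_max_comp _ x01) => c c01.
have := b01 i j; have := c01 i j.
rewrite !in_itv /= => /andP[? ?] /andP[? ?].
by rewrite !mxE ler_norml; apply/andP; split; lra.
Qed.

Lemma chebyshev_dist_attained :
  exists2 x, mx01 x & `|b - max_comp T A x| <= chebyshev_dist T A b.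
Proof.
set D := chebyshev_dist T A b.
pose d N : R := D + harmonic N.
have d0 N : 0 <= d N.
  by apply: addr_ge0; [exact: chebyshev_dist_ge0|exact: harmonic_ge0].
have up01 N := mx01_upper _ _ b01 (d0 N).
(* Taking greatest subsolutions instead of arbitrary near-minimizers makes each coordinate monotone
   in [N], so convergence requires no compactness argument. *)
pose X N := min_res_comp T A^T (upper b (d N)).
have X01 N : mx01 (X N) := mx01_min_res_comp _ (up01 N).
have X_dist N : `|b - max_comp T A (X N)| <= d N.
  apply/lower_le_FmapP => //.
  have hasI : has_inf [set `|b - c| | c in consistent_set T A].
    split; last by exists 0 => _ [c _ <-].
    exists `|b - max_comp T A (X N)|; exists (max_comp T A (X N)) => //.
    exact: max_comp_consistent.
  (* Some consistent second member is closer to [b] than [d N]; its solution [x] makes [d N]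
     feasible, which bounds the distance for [X N]. *)
  have [_ [_ [_ [x x01 <-]] <-] lt_d] := inf_adherent (harmonic_gt0 N) hasI.
  by apply: (lower_le_Fmap _ _ b01 (d0 N) _ x01); exact: ltW lt_d.
have X_homo j : {homo (fun N => X N j 0) : N N' / (N <= N')%N >-> N' <= N}.
  move=> N N' NN'; apply: le_min_res_comp => // i; rewrite !mxE.
  rewrite le_min !ge_min lexx orbT andbT lerD2l lerD2l.
  by rewrite lef_pV2 ?posrE ?ltr0n// ler_nat ltnS NN'.
pose x : 'cV[R]_m := \col_j inf (range (fun N => X N j 0)).
have Xx j : X N j 0 @[N --> \oo] --> x j 0.
  rewrite mxE; apply: nonincreasing_cvgn => //.
  by exists 0 => _ [N _ <-]; have := X01 N j 0; rewrite in_itv /= => /andP[].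
have x01 : mx01 x.
  move=> j k; rewrite ord1.
  apply: (@closed_cvg _ _ \oo _ _ (fun z : R => z \in `[0, 1]) _ _ _ (Xx j)).
    exact: itv_closed.
  by apply: nearW => N; exact: X01.
exists x => //; apply/mx_norm_leP => [|i k]; first exact: chebyshev_dist_ge0.
rewrite ord1 {k}.
apply: (@ler_cvg_to _ \oo _ _ (fun N => `|(b - max_comp T A (X N)) i 0|) d).
- rewrite !mxE; under eq_fun do rewrite !mxE.
  apply: cvg_norm; apply: cvgB; first exact: cvg_cst.
  apply: cvg_bigmax => j; apply: tnorm_cvg (Xx j); [exact: A01| |exact: x01].
  by move=> N; exact: X01.
- rewrite -[X in _ --> X]addr0.
  by apply: cvgD; [exact: cvg_cst|exact: cvg_harmonic].
- by apply: nearW => N; move: i (0 : 'I_1); apply/mx_norm_leP.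
Qed.

End solutions.

Theorem theorem1 (R : realType) (T : R -> R -> R) (n m : nat)
  (A : 'M[R]_(n, m)) (b : 'cV[R]_n)
  (n_gt0 : (0 < n)%N) (m_gt0 : (0 < m)%N)
  (T_tnorm : tnorm T) (T_cont : tnorm_continuous T)
  (A01 : mx01 A) (b01 : mx01 b) :
  is_min [set d : R | d \in `[0, 1] /\
                      cV_le (lower b d) (Fmap T A (upper b d))]
         (chebyshev_dist T A b).
Proof.
split.
  have D0 : 0 <= chebyshev_dist T A b by exact: chebyshev_dist_ge0.
  split; first by rewrite in_itv /= D0 chebyshev_dist_le1.
  have [x x01 xD] := chebyshev_dist_attained _ _ T_tnorm T_cont _ _ _ A01 _ b01.
  exact: (lower_le_Fmap _ _ T_tnorm T_cont _ _ _ A01 _ _ b01 D0 _ x01 xD).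
move=> d [+ lo]; rewrite in_itv /= => /andP[d0 _].
have /lower_le_FmapP := lo.
move=> /(_ T_tnorm T_cont A01 b01 d0); apply: le_trans.
(* [Fmap] unfolds to [max_comp] of a vector of the unit cube, hence is a consistent second
   member. *)
apply: chebyshev_dist_le => //.
by apply: mx01_min_res_comp => //; exact: mx01_upper.
Qed.
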